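(* The reachability problem for singular hybrid automata with two stopwatch variables is decidable.
   Context: A singular hybrid automaton is $\mathcal H=(Q,Q_0,\Sigma,V,\Delta,I,F)$ where $Q$ is a finite set of modes, $Q_0\subseteq Q$ the initial modes, $\Sigma$ a finite set of actions, $V$ a finite ordered set of real-valued variables, $\Delta\subseteq Q\times\mathrm{Rect}(V)\times\Sigma\times2^V\times Q$ the transition relation (guard, action, set of variables reset to $0$), $I:Q\to\mathrm{Rect}(V)$ the mode invariants and $F:Q\to\mathbb Q^{|V|}$ the constant rate of each variable in each mode. $\mathrm{Rect}(V)$ consists of finite conjunctions of constraints $x\bowtie c$ with $x\in V$, $c$ an integer and $\bowtie\in\{<,\le,=,>,\ge\}$. In a mode $q$ time $t\ge0$ may elapse, changing the valuation $\nu$ to $\nu+F(q)t$ while the invariant holds; a transition $(q,g,a,R,q')$ can be taken when the current valuation satisfies $g$, resetting the variables in $R$ to $0$. Two stopwatch variables: $V=\{x,y\}$ and $F(q)\in\{0,1\}^2$ for all modes $q$. Reachability problem: given $\mathcal H$ and a set of final modes, decide whether some final mode is reachable by a run starting from an initial mode with all variables equal to $0$. *)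

(* Defs.v *)
From Stdlib Require Import Relation_Operators.
From Stdlib Require List.
From mathcomp Require Import all_boot all_order all_algebra.
From mathcomp Require Import reals.

Set Implicit Arguments.
Unset Strict Implicit.
Unset Printing Implicit Defensive.

Import Order.TTheory GRing.Theory Num.Theory.
Local Open Scope ring_scope.

(* Decidability is stated with an explicit model of computation, because
   [{P} + {~ P}] is inhabited for every [P] under the classical axioms used by
   the real numbers.  The model is N. D. Jones's WHILE language
   ("Computability and Complexity", MIT Press, 1997): imperative programs
   over binary trees, a Turing-complete language in which finite data are
   directly represented. *)

Inductive tree := Nil | Cons of tree & tree.

Definition hd (d : tree) : tree := if d is Cons a _ then a else Nil.
Definition tl (d : tree) : tree := if d is Cons _ b then b else Nil.

Fixpoint eq_tree (d e : tree) : bool :=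
  match d, e with
  | Nil, Nil => true
  | Cons a b, Cons a' b' => eq_tree a a' && eq_tree b b'
  | _, _ => false
  end.

Definition bool_tree (b : bool) : tree := if b then Cons Nil Nil else Nil.

Inductive expr :=
  | Var of nat
  | Quote of tree
  | ECons of expr & expr
  | EHd of expr
  | ETl of expr
  | EEq of expr & expr.

Inductive cmd :=
  | Assign of nat & expr
  | Seq of cmd & cmd
  | While of expr & cmd.

Definition store := nat -> tree.

Definition update (s : store) (i : nat) (d : tree) : store :=
  fun j => if j == i then d else s j.

Fixpoint eval (s : store) (e : expr) : tree :=
  match e with
  | Var i => s i
  | Quote d => d
  | ECons e1 e2 => Cons (eval s e1) (eval s e2)
  | EHd e1 => hd (eval s e1)
  | ETl e1 => tl (eval s e1)
  | EEq e1 e2 => bool_tree (eq_tree (eval s e1) (eval s e2))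
  end.

Inductive exec : cmd -> store -> store -> Prop :=
  | ExecAssign s i e : exec (Assign i e) s (update s i (eval s e))
  | ExecSeq s1 s2 s3 c1 c2 :
      exec c1 s1 s2 -> exec c2 s2 s3 -> exec (Seq c1 c2) s1 s3
  | ExecWhileNil s e c : eval s e = Nil -> exec (While e c) s s
  | ExecWhileCons s1 s2 s3 e c :
      eval s1 e <> Nil -> exec c s1 s2 -> exec (While e c) s2 s3 ->
      exec (While e c) s1 s3.

(* The input is placed in variable 0, all other variables being initially
   [Nil]; the output is the final value of variable 0. *)
Definition computes (c : cmd) (input output : tree) : Prop :=
  exists2 s : store, exec c (update (fun=> Nil) 0 input) s & s 0%N = output.

(* The problem "given [i : I] such that [valid i], does [P i] hold?", inputs
   being presented as trees by [code], is solved by one program that halts on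
   every valid input. *)
Definition decidable_problem (I : Type) (code : I -> tree)
    (valid P : I -> Prop) : Prop :=
  exists c : cmd, forall i : I, valid i ->
    exists2 b : bool, computes c (code i) (bool_tree b) & (b <-> P i).

Inductive comparison_op := OpLt | OpLe | OpEq | OpGt | OpGe.

Record constraint (n : nat) := Constraint {
  cvar : 'I_n; cop : comparison_op; cbound : int }.

Definition rect (n : nat) := seq (constraint n).

(* The ordered set of variables is ['I_n]. *)
Record transition (n : nat) (Q Sigma : Type) := Transition {
  source : Q; guard : rect n; label : Sigma; resets : {set 'I_n}; target : Q }.

Record singular_automaton (n : nat) := SingularAutomaton {
  mode : finType;
  initial : {set mode};
  action : finType;
  transitions : seq (transition n mode action);
  invariant : mode -> rect n;
  rate : mode -> 'rV[rat]_n }.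

Definition stopwatch_automaton (n : nat) (H : singular_automaton n) : Prop :=
  forall (q : mode H) (x : 'I_n), rate q 0 x = 0 \/ rate q 0 x = 1.

Section Semantics.
Variables (R : realType) (n : nat).

Definition compare (op : comparison_op) (a b : R) : bool :=
  match op with
  | OpLt => a < b
  | OpLe => a <= b
  | OpEq => a == b
  | OpGt => a > b
  | OpGe => a >= b
  end.

Definition sat (nu : 'rV[R]_n) (g : rect n) : bool :=
  all (fun k => compare (cop k) (nu 0 (cvar k)) (cbound k)%:~R) g.

Definition reset (nu : 'rV[R]_n) (X : {set 'I_n}) : 'rV[R]_n :=
  \row_(x < n) (if x \in X then 0 else nu 0 x).

Variable H : singular_automaton n.

Definition config : Type := mode H * 'rV[R]_n.

Definition elapse (q : mode H) (nu : 'rV[R]_n) (t : R) : 'rV[R]_n :=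
  nu + t *: map_mx ratr (rate q).

(* Every configuration visited by a run satisfies the invariant of its mode:
   at the start, throughout a delay, and upon entering a mode by a jump. *)
Inductive step : config -> config -> Prop :=
  | Delay (q : mode H) (nu : 'rV[R]_n) (t : R) :
      0 <= t ->
      (forall u : R, 0 <= u <= t -> sat (elapse q nu u) (invariant q)) ->
      step (q, nu) (q, elapse q nu t)
  | Jump (e : transition n (mode H) (action H)) (nu : 'rV[R]_n) :
      List.In e (transitions H) ->
      sat nu (guard e) ->
      sat (reset nu (resets e)) (invariant (target e)) ->
      step (source e, nu) (target e, reset nu (resets e)).

Definition reachable (final : {set mode H}) : Prop :=
  exists (q0 q : mode H) (nu : 'rV[R]_n),
    [/\ q0 \in initial H, sat 0 (invariant q0), q \in final &
        clos_refl_trans config step (q0, 0) (q, nu)].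

End Semantics.

Record reach_instance (n : nat) := ReachInstance {
  automaton : singular_automaton n;
  final : {set mode automaton} }.

Definition reach_problem (R : realType) (n : nat) (I : reach_instance n) :
  Prop := reachable R (final I).

(* Numbers are written in unary, finite sets as lists of ranks of their
   elements, and maps with finite domain as lists of values. *)

Definition nat_tree (k : nat) : tree := iter k (Cons Nil) Nil.

Definition list_tree : seq tree -> tree := foldr Cons Nil.

Definition seq_tree (T : Type) (f : T -> tree) (s : seq T) : tree :=
  list_tree (map f s).

Definition int_tree (z : int) : tree :=
  Cons (bool_tree (z < 0)) (nat_tree `|z|%N).

Definition rat_tree (r : rat) : tree :=
  Cons (int_tree (numq r)) (int_tree (denq r)).

Definition elt_tree (T : finType) (x : T) : tree := nat_tree (enum_rank x).

Definition set_tree (T : finType) (A : {set T}) : tree :=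
  seq_tree (@elt_tree T) (enum A).

Definition map_tree (T : finType) (U : Type) (f : U -> tree) (g : T -> U) :
  tree := seq_tree (fun x => f (g x)) (enum T).

Definition op_tree (op : comparison_op) : tree :=
  nat_tree match op with
           | OpLt => 0 | OpLe => 1 | OpEq => 2 | OpGt => 3 | OpGe => 4
           end.

Definition constraint_tree (n : nat) (k : constraint n) : tree :=
  list_tree [:: elt_tree (cvar k); op_tree (cop k); int_tree (cbound k)].

Definition rect_tree (n : nat) : rect n -> tree :=
  seq_tree (@constraint_tree n).

Definition transition_tree (n : nat) (Q Sigma : finType)
    (e : transition n Q Sigma) : tree :=
  list_tree [:: elt_tree (source e); rect_tree (guard e); elt_tree (label e);
                set_tree (resets e); elt_tree (target e)].

Definition automaton_tree (n : nat) (H : singular_automaton n) : tree :=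
  list_tree
    [:: nat_tree n;
        nat_tree #|mode H|;
        set_tree (initial H);
        nat_tree #|action H|;
        seq_tree (@transition_tree n (mode H) (action H)) (transitions H);
        map_tree (@rect_tree n) (@invariant n H);
        map_tree (fun v : 'rV[rat]_n => map_tree rat_tree (v 0)) (@rate n H)].

Definition instance_tree (n : nat) (I : reach_instance n) : tree :=
  Cons (automaton_tree (automaton I)) (set_tree (final I)).

(* Main.v *)
(* Merge everything beyond a bound [M] on the constants of the automaton. With
   only two variables of rates 0 and 1, the classical regions (integer parts,
   integrality, order of the two fractional parts) then form a finite
   bisimulation although each variable can be stopped independently: the
   sequence of regions crossed by a delay in a given mode depends only on the
   starting region. With three variables this fails, because it may depend on
   the order of the differences of the fractional parts.

   Reachability thus reduces to exploring the finite graph of pairs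
   (mode, region). WHILE programs compute a class of tree functions closed under
   composition, pairing, conditionals and folds over lists, and the exploration,
   iterated as many times as there are pairs, is in this class. *)

From Stdlib Require Import Relation_Operators.
From Stdlib Require List.
From mathcomp Require Import all_boot all_order all_algebra.
From mathcomp Require Import ring lra zify.
Require Import Defs.
From mathcomp Require Import reals.

Set Implicit Arguments.
Unset Strict Implicit.
Unset Printing Implicit Defensive.

Import Order.TTheory GRing.Theory Num.Theory.

(** * WHILE-computable functions *)

(** The program must halt from every store. Variable 1 is preserved because it serves as a stack
    when programs are combined; the other variables are scratch space. *)
Definition computable (f : tree -> tree) : Prop :=
  exists c : cmd, forall s : store, exists2 s' : store,
    exec c s s' & s' 0 = f (s 0) /\ s' 1 = s 1.

Lemma computable_expr (e : expr) (f : tree -> tree) :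
  (forall s, eval s e = f (s 0)) -> computable f.
Proof.
move=> ef; exists (Assign 0 e) => s; exists (update s 0 (eval s e)).
  exact: ExecAssign.
by rewrite /update /= ef.
Qed.

Lemma computable_id : computable (fun x => x).
Proof. exact: (@computable_expr (Var 0)). Qed.

Lemma computable_const (t : tree) : computable (fun=> t).
Proof. exact: (@computable_expr (Quote t)). Qed.

Lemma computable_comp f g :
  computable f -> computable g -> computable (fun x => f (g x)).
Proof.
move=> [cf fP] [cg gP]; exists (Seq cg cf) => s.
have [s1 e1 [v1 w1]] := gP s; have [s2 e2 [v2 w2]] := fP s1.
by exists s2; [exact: ExecSeq e1 e2 | rewrite v2 w2 v1 w1].
Qed.

Lemma computable_hd f : computable f -> computable (fun x => hd (f x)).
Proof.
exact: (computable_comp (@computable_expr (EHd (Var 0)) hd (fun=> erefl))).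
Qed.

Lemma computable_tl f : computable f -> computable (fun x => tl (f x)).
Proof.
exact: (computable_comp (@computable_expr (ETl (Var 0)) tl (fun=> erefl))).
Qed.

(** The top of the stack in variable 1 holds the input while [cf] runs, then the value of [f] while
    [cg] runs. *)
Lemma computable_Cons f g :
  computable f -> computable g -> computable (fun x => Cons (f x) (g x)).
Proof.
move=> [cf fP] [cg gP].
exists (Seq (Assign 1 (ECons (Var 0) (Var 1)))
       (Seq cf
       (Seq (Assign 2 (EHd (Var 1)))
       (Seq (Assign 1 (ECons (Var 0) (ETl (Var 1))))
       (Seq (Assign 0 (Var 2))
       (Seq cg
       (Seq (Assign 0 (ECons (EHd (Var 1)) (Var 0)))
            (Assign 1 (ETl (Var 1)))))))))) => s.
have [s1 e1 [v1 w1]] := fP (update s 1 (Cons (s 0) (s 1))).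
set s2 := update s1 2 (hd (s1 1)).
set s3 := update s2 1 (Cons (s2 0) (tl (s2 1))).
have [s4 e4 [v4 w4]] := gP (update s3 0 (s3 2)).
set s5 := update s4 0 (Cons (hd (s4 1)) (s4 0)).
exists (update s5 1 (tl (s5 1))).
  by do 7! [apply: ExecSeq; first by [apply: ExecAssign | exact: e1 | exact: e4]];
     exact: ExecAssign.
by rewrite /s5 /update /= v4 w4 /s3 /s2 /update /= v1 w1.
Qed.

Definition eqt (a b : tree) : tree := bool_tree (eq_tree a b).

Lemma computable_eqt f g :
  computable f -> computable g -> computable (fun x => eqt (f x) (g x)).
Proof.
move=> cf cg; pose h p := eqt (hd p) (tl p).
apply: (@computable_comp h (fun x => Cons (f x) (g x))).
  exact: (@computable_expr (EEq (EHd (Var 0)) (ETl (Var 0)))).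
exact: computable_Cons.
Qed.

(** The hypothesis on [w] includes termination: each application supplies the number of iterations
    for every input. *)
Lemma computable_loop (i h w : tree -> tree) :
  computable i -> computable h ->
  (forall x, exists n, [/\ forall m, m < n -> hd (iter m h (i x)) <> Nil,
                           hd (iter n h (i x)) = Nil & w x = iter n h (i x)]) ->
  computable w.
Proof.
move=> [c0 iP] [c hP] wP; exists (Seq c0 (While (EHd (Var 0)) c)) => s.
have [s0 e0 [v0 w0]] := iP s.
suffices [s' e' [v' w']] : exists2 s' : store,
    exec (While (EHd (Var 0)) c) s0 s' & s' 0 = w (s 0) /\ s' 1 = s0 1.
  by exists s'; [exact: ExecSeq e0 e' | rewrite v' w' w0].
have [n [lt_n eq_n ->]] := wP (s 0); rewrite -v0 in lt_n eq_n *.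
elim: n s0 {e0 v0 w0} lt_n eq_n => [|n IHn] s0 lt_n eq_n.
  by exists s0 => //; apply: ExecWhileNil.
have [s1 e1 [v1 w1]] := hP s0.
have [m ltmn||s2 e2 [v2 w2]] := IHn s1; first by rewrite v1 -iterSr; apply: lt_n.
  by rewrite v1 -iterSr.
exists s2; last by rewrite v2 w2 w1 v1 -iterSr.
by apply: ExecWhileCons e1 e2; apply: (lt_n 0).
Qed.

Definition ift (c a b : tree) : tree := if c is Nil then b else a.

(** A conditional is a loop run at most once, whose body clears the test and overwrites the second
    alternative with the first. Both alternatives are evaluated beforehand, which is harmless since
    all functions are total. *)
Lemma computable_ift f g h : computable f -> computable g -> computable h ->
  computable (fun x => ift (f x) (g x) (h x)).
Proof.
move=> cf cg ch; pose i x := Cons (f x) (Cons (g x) (h x)).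
pose w x := Cons Nil (Cons (g x) (ift (f x) (g x) (h x))).
apply: (@computable_comp (fun p => tl (tl p)) w).
  exact/computable_tl/computable_tl/computable_id.
apply: (@computable_loop i
         (fun p => Cons Nil (Cons (hd (tl p)) (hd (tl p))))).
- by do 2! apply: computable_Cons => //.
- by do 2! [apply: computable_Cons; first by
    [exact: computable_const | exact/computable_hd/computable_tl/computable_id]];
    exact/computable_hd/computable_tl/computable_id.
move=> x; rewrite /w /i; case: (f x) => [|a b]; first by exists 0.
by exists 1; split=> // -[].
Qed.

(** A unary numeral is a list of [Nil], so this fold also iterates a given number of times. *)
Fixpoint foldt (F : tree -> tree -> tree) (a l : tree) : tree :=
  if l is Cons e l' then foldt F (F a e) l' else a.

(* The loop state is [Cons l (Cons x a)], where [l] is the rest of the list,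
   [x] the parameter and [a] the accumulator. *)
Lemma computable_foldt (F : tree -> tree -> tree -> tree) f g :
  computable (fun p => F (hd p) (hd (tl p)) (tl (tl p))) ->
  computable f -> computable g ->
  computable (fun x => foldt (F x) (f x) (g x)).
Proof.
move=> cF cf cg; pose i x := Cons (g x) (Cons x (f x)).
pose h p := Cons (tl (hd p)) (Cons (hd (tl p))
              (F (hd (tl p)) (tl (tl p)) (hd (hd p)))).
pose w x := Cons Nil (Cons x (foldt (F x) (f x) (g x))).
apply: (@computable_comp (fun p => tl (tl p)) w).
  exact/computable_tl/computable_tl/computable_id.
apply: (@computable_loop i h).
- by do 2! [apply: computable_Cons => //]; exact: computable_id.
- apply: computable_Cons; first exact/computable_tl/computable_hd/computable_id.
  apply: computable_Cons; first exact/computable_hd/computable_tl/computable_id.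
  pose v p := Cons (hd (tl p)) (Cons (tl (tl p)) (hd (hd p))).
  apply: (@computable_comp _ v cF).
  apply: computable_Cons; first exact/computable_hd/computable_tl/computable_id.
  apply: computable_Cons; first exact/computable_tl/computable_tl/computable_id.
  exact/computable_hd/computable_hd/computable_id.
move=> x; rewrite /w /i; elim: (g x) (f x) => [|d _ l IHl] a; first by exists 0.
have [n [lt_n eq_n Dn]] := IHl (F x a d).
exists n.+1; split; rewrite ?iterSr //.
by case=> // m ltmn; rewrite iterSr; apply: lt_n.
Qed.

(** * Regions *)

(* [(m, false)] stands for the point [m], and [(m, true)] for the interval
   [(m, m + 1)], or for [(M, +oo)] when [m = M]. In a region, the two booleans
   tell whether the fractional part of the first, resp. second, coordinate is
   the smaller one; both are [false] unless both coordinates are in bounded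
   intervals. *)
Definition coord : Type := nat * bool.
Definition region : Type := coord * coord * (bool * bool).

Section Regions.
Variable M : nat.

Definition capped (a : coord) : bool := a == (M, true).

Definition fractional (a : coord) : bool := a.2 && ~~ capped a.

Definition tick (a : coord) : coord := if a.2 then (a.1.+1, false) else (a.1, true).

(** [mx] and [my] tell which coordinates evolve below the cap, [jx] and [jy] which ones change class
    at the next crossing. When both evolve, a coordinate at an integer leaves it at once; otherwise
    the larger fractional part reaches the next integer first, and equal ones do so together. When
    one evolves alone and its fractional part does not exceed the other, only the order changes. A
    coordinate that has just left an integer has the smaller fractional part. *)
Definition region_succ (rx ry : bool) (r : region) : region :=
  let: (a, b, (l, g)) := r in
  let mx := rx && ~~ capped a in
  let my := ry && ~~ capped b in
  let rel := fractional a && fractional b in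
  let jx := mx && (if my then ~~ a.2 || b.2 && ~~ l else ~~ rel || g) in
  let jy := my && (if mx then ~~ b.2 || a.2 && ~~ g else ~~ rel || l) in
  let a' := if jx then tick a else a in
  let b' := if jy then tick b else b in
  let o' :=
    if jx || jy then
      if fractional a' && fractional b' then (jx && ~~ jy, jy && ~~ jx)
      else (false, false)
    else if mx || my then (my && ~~ g, mx && ~~ l) else (l, g) in
  (a', b', o').

Definition coord_rank (a : coord) : nat := a.1.*2 + a.2.

(** Progress measure of a delay. The order term goes through 0, 1, 2 as an evolving coordinate
    catches up with a stopped one and overtakes it; the factor 3 makes every change of class
    outweigh this term. *)
Definition region_rank (rx ry : bool) (r : region) : nat :=
  let: (a, b, (l, g)) := r in
  3 * (coord_rank a + coord_rank b) + (if rx then g + ~~ l else l + ~~ g).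

Lemma region_rank_succ rx ry a b o :
  ~~ (o.1 && o.2) ->
  rx && ~~ capped a || ry && ~~ capped b ->
  region_rank rx ry (a, b, o) < region_rank rx ry (region_succ rx ry (a, b, o)).
Proof.
case: a b o => [m a] [n b] [l g]; rewrite /region_succ /fractional /region_rank.
case: (capped (m, a)) (capped (n, b)) => [] [];
  case: rx; case: ry; case: a; case: b; case: l; case: g => //= _ _;
  rewrite /coord_rank /=; try (case: ifP => _ /=); lia.
Qed.

(** * Regions as sets of pairs of reals *)

Local Open Scope ring_scope.
Variable R : realType.
Implicit Types (rx ry : bool) (x y t u : R) (r : region) (a b : coord).

(** The boolean index repeats [capped], so that case analysis on [in_coord] also evaluates
    [capped a]. *)
Variant coord_spec (x : R) : coord -> bool -> Prop :=
  | CoordInt m of (m <= M)%N & x = m%:R : coord_spec x (m, false) false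
  | CoordFrac m of (m < M)%N & m%:R < x & x < m%:R + 1 :
      coord_spec x (m, true) false
  | CoordCap of M%:R < x : coord_spec x (M, true) true.

Definition in_coord (x : R) (a : coord) : Prop := coord_spec x a (capped a).

Definition in_region (x y : R) (r : region) : Prop :=
  let: (a, b, o) := r in
  [/\ in_coord x a, in_coord y b &
      o = if fractional a && fractional b
          then (x - a.1%:R < y - b.1%:R, y - b.1%:R < x - a.1%:R)
          else (false, false)].

Lemma in_coord_int m x : (m <= M)%N -> x = m%:R -> in_coord x (m, false).
Proof. by rewrite /in_coord /capped xpair_eqE andbF; constructor. Qed.

Lemma in_coord_cap x : M%:R < x -> in_coord x (M, true).
Proof. by rewrite /in_coord /capped eqxx; constructor. Qed.

Lemma in_coord_open m x :
  (m <= M)%N -> m%:R < x -> x < m%:R + 1 -> in_coord x (m, true).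
Proof.
rewrite leq_eqVlt => /predU1P[-> Mx _|ltmM mx xm]; first exact: in_coord_cap.
by rewrite /in_coord /capped xpair_eqE ltn_eqF //; constructor.
Qed.

Lemma capped_top : capped (M, true).
Proof. exact: eqxx. Qed.

(** Either [P] lasts until [t0], when [Q] begins, or [Q] holds immediately after time 0; the second
    alternative says nothing about time 0 itself. *)
Definition crossing (P Q : R -> Prop) : Prop := exists2 t0, 0 < t0 &
  (forall u, 0 <= u < t0 -> P u) /\ Q t0 \/ (forall u, 0 < u <= t0 -> Q u).

Lemma capped_frac m : (m < M)%N -> capped (m, true) = false.
Proof. by move=> ltmM; rewrite /capped xpair_eqE ltn_eqF. Qed.

Ltac solve_coord := lazymatch goal with
  | |- in_coord _ (M, true) => apply: in_coord_cap; lra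
  | |- in_coord _ (_, true) => apply: in_coord_open; [lia | lra | lra]
  | |- in_coord _ (_, false) => apply: in_coord_int; [lia | rewrite -?natr1; lra]
  end.
Ltac solve_bool := lazymatch goal with
  | |- true = _ => apply/esym/idP; lra
  | |- false = _ => apply/esym/negbTE; rewrite -leNgt; lra
  end.
Ltac solve_order := rewrite /= ?capped_top ?andbF; try (case: ifP => // _);
  solve [done | congr pair; solve_bool].
Ltac solve_region := split; [solve_coord | solve_coord | solve_order].
Ltac solve_leaving t := exists t; [lra | left; split;
  [move=> u /andP[? ?]; solve_region | solve_region]].
Ltac solve_entering t :=
  exists t; [lra | right=> u /andP[? ?]; solve_region].

Definition region_crosses (rx ry : bool) (x y : R) (r : region) : Prop :=
  crossing (fun u => in_region (x + u * rx%:R) (y + u * ry%:R) r)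
    (fun u => in_region (x + u * rx%:R) (y + u * ry%:R) (region_succ rx ry r)).

Lemma region_crosses_frac rx ry x y m n :
  (m < M)%N -> m%:R < x < m%:R + 1 -> (n < M)%N -> n%:R < y < n%:R + 1 ->
  rx || ry ->
  region_crosses rx ry x y
    ((m, true), (n, true), (x - m%:R < y - n%:R, y - n%:R < x - m%:R)).
Proof.
move=> ltmM /andP[mx xm] ltnM /andP[ny yn].
have [cm cn] := (capped_frac ltmM, capped_frac ltnM).
rewrite /region_crosses /region_succ /in_region /fractional.
(* The exit time is when the first evolving coordinate reaches its next integer, or when the
   fractional parts become equal. From equal fractional parts with one coordinate evolving, the
   successor is entered at once and any time before the next integer will do. *)
case: rx; case: ry; rewrite /tick /= ?cm ?cn //= => _;
  have [c|c|c] := ltgtP (x - m%:R) (y - n%:R); rewrite /= ?cm ?cn /= {cm cn}.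
- solve_leaving (n%:R + 1 - y).
- solve_leaving (m%:R + 1 - x).
- solve_leaving (m%:R + 1 - x).
- solve_leaving (y - n%:R - (x - m%:R)).
- solve_leaving (m%:R + 1 - x).
- solve_entering ((m%:R + 1 - x) / 2).
- solve_leaving (n%:R + 1 - y).
- solve_leaving (x - m%:R - (y - n%:R)).
- solve_entering ((n%:R + 1 - y) / 2).
Qed.

Lemma region_crosses_int rx ry x m b : (m <= M)%N -> in_coord x b ->
  rx || ry && ~~ capped b ->
  region_crosses rx ry m%:R x ((m, false), b, (false, false)).
Proof.
rewrite /region_crosses /region_succ /in_region /fractional => lemM Hb.
have cm : capped (m, false) = false by rewrite /capped xpair_eqE andbF.
case: b _ / Hb => [n lenM ->|n ltnM nx xn|Mx]; case: rx; case: ry;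
  rewrite /tick /= ?cm //= => _.
1-3: solve_entering (2^-1 : R).
(* These two times keep the second coordinate in its interval if it evolves, and the fractional part
   of the first below that of the second if the second is stopped. *)
- solve_entering ((n%:R + 1 - x) / 2).
- solve_entering ((x - n%:R) / 2).
- solve_leaving (n%:R + 1 - x).
1-2: solve_entering (2^-1 : R).
Qed.

Lemma region_crosses_cap rx ry x y b : M%:R < x -> in_coord y b ->
  ry && ~~ capped b ->
  region_crosses rx ry x y ((M, true), b, (false, false)).
Proof.
rewrite /region_crosses /region_succ /in_region /fractional => Mx Hb.
case: b _ / Hb => [n lenM ->|n ltnM ny yn|//]; case: rx; case: ry;
  rewrite /tick /= ?capped_top //= => _.
1-2: solve_entering (2^-1 : R).
1-2: solve_leaving (n%:R + 1 - y).
Qed.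

(** Exchanging the coordinates shortens the case analysis of [region_crossing]. *)
Definition coord_swap (r : region) : region :=
  let: (a, b, (l, g)) := r in (b, a, (g, l)).

Lemma region_succ_swap rx ry r :
  region_succ ry rx (coord_swap r) = coord_swap (region_succ rx ry r).
Proof.
case: r => [[a b] [l g]]; rewrite /region_succ /=.
rewrite [fractional b && _]andbC.
set mx := rx && _; set my := ry && _; set rel := fractional a && _.
set jx := mx && _; set jy := my && _.
rewrite [jy || _]orbC [my || _]orbC [fractional (if jy then _ else _) && _]andbC.
by case: (jx || jy); [case: (_ && _) | case: (mx || my)].
Qed.

Lemma in_region_swap x y r : in_region y x (coord_swap r) <-> in_region x y r.
Proof.
case: r => [[a b] [l g]] /=; rewrite [fractional b && _]andbC.
by split=> -[Ha Hb]; case: ifP => _ [-> ->].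
Qed.

Lemma region_crosses_swap rx ry x y r :
  region_crosses ry rx y x (coord_swap r) -> region_crosses rx ry x y r.
Proof.
case=> t t0 H; exists t => //; case: H => [[H Ht]|H]; [left; split|right].
- by move=> u /H /in_region_swap.
- by move: Ht; rewrite region_succ_swap => /in_region_swap.
- by move=> u /H; rewrite region_succ_swap => /in_region_swap.
Qed.

(** Every point of the region crosses into the same next region, which makes regions a bisimulation
    for delays. Up to exchanging coordinates, one of them is an integer, or both lie in bounded
    intervals, or one is beyond the bound. *)
Lemma region_crossing rx ry x y a b o :
  in_region x y (a, b, o) ->
  rx && ~~ capped a || ry && ~~ capped b ->
  region_crosses rx ry x y (a, b, o).
Proof.
move=> [Ha Hb ->] {o}; rewrite /fractional.
case: Ha (Ha) => [m lemM -> _|m ltmM mx xm|Mx].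
- by rewrite /= andbT; apply: region_crosses_int.
- case: Hb => [n lenM ->|n ltnM ny yn|My] Ha.
  + rewrite !andbT !andbF => H; apply: region_crosses_swap.
    by apply: region_crosses_int; rewrite // capped_frac // andbT orbC.
  + by rewrite !andbT => H; apply: region_crosses_frac; rewrite ?mx ?ny.
  + rewrite !andbF orbF andbT => H; apply: region_crosses_swap.
    by apply: region_crosses_cap; rewrite // capped_frac // andbT.
- by rewrite andbF => Ha; apply: region_crosses_cap.
Qed.

(** * Delays as sequences of region successors *)

Lemma in_coord_le x a : in_coord x a -> (a.1 <= M)%N.
Proof. by case=> // m /ltnW. Qed.

Lemma in_region_order x y a b o : in_region x y (a, b, o) -> ~~ (o.1 && o.2).
Proof.
case=> _ _ ->; case: ifP => //= _.
by apply/negP => /andP[/lt_trans H /H]; rewrite ltxx.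
Qed.

Lemma region_rank_le rx ry x y r :
  in_region x y r -> (region_rank rx ry r <= 12 * M + 8)%N.
Proof.
case: r => [[[m a] [n b]] [l g]] [/in_coord_le Hm /in_coord_le Hn _].
rewrite /region_rank /coord_rank.
by move: Hm Hn; case: rx a b l g => [] [] [] [] [] /=; lia.
Qed.

Lemma coord_stuck (rx : bool) x a u :
  in_coord x a -> ~~ (rx && ~~ capped a) -> 0 <= u ->
  in_coord (x + u * rx%:R) a.
Proof.
case: rx => [|Hx _ _]; last by rewrite mulr0 addr0.
case=> [m|m|Mx] //= _ u_ge0; rewrite mulr1; apply: in_coord_cap; lra.
Qed.

Lemma region_stuck rx ry x y a b o u :
  in_region x y (a, b, o) ->
  ~~ (rx && ~~ capped a || ry && ~~ capped b) -> 0 <= u ->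
  in_region (x + u * rx%:R) (y + u * ry%:R) (a, b, o).
Proof.
rewrite negb_or => -[Ha Hb Ho] /andP[stx sty] u0.
split; [exact: coord_stuck | exact: coord_stuck |].
rewrite Ho; case: ifP => // /andP[/andP[_ /negPf ca] /andP[_ /negPf cb]].
by move: stx sty; rewrite ca cb !andbT => /negPf-> /negPf->; rewrite !mulr0 !addr0.
Qed.

Lemma region_succ_stuck rx ry a b o :
  ~~ (rx && ~~ capped a || ry && ~~ capped b) ->
  region_succ rx ry (a, b, o) = (a, b, o).
Proof.
by rewrite /region_succ; case: o => l g; case: (rx && _); case: (ry && _).
Qed.

(** One crossing visits only [r] and its successor, so an invariant that holds in these two regions
    holds throughout the delay. If nothing evolves below the cap, the successor is [r] and the delay
    is 0. *)
Lemma region_succ_sound rx ry x y r : in_region x y r ->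
  exists t, [/\ 0 <= t,
      in_region (x + t * rx%:R) (y + t * ry%:R) (region_succ rx ry r)
    & forall u, 0 <= u <= t ->
      in_region (x + u * rx%:R) (y + u * ry%:R) r \/
      in_region (x + u * rx%:R) (y + u * ry%:R) (region_succ rx ry r)].
Proof.
case: r => [[a b] o] Hr.
have [mv|st] := boolP (rx && ~~ capped a || ry && ~~ capped b); last first.
  exists 0; rewrite region_succ_stuck // !mul0r !addr0; split=> // u.
  by case/andP=> u0 _; left; apply: region_stuck.
have [t t0 H] := region_crossing Hr mv; exists t.
case: H => [[H Ht]|H]; split; rewrite ?ltW //.
- move=> u /andP[u0]; rewrite le_eqVlt => /predU1P[->|ut]; first by right.
  by left; apply: H; rewrite u0.
- by apply: H; rewrite t0 lexx.
- move=> u /andP[]; rewrite le_eqVlt => /predU1P[<- _|u0 ut].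
    by left; rewrite !mul0r !addr0.
  by right; apply: H; rewrite u0.
Qed.

(** The rank is bounded and increases at each crossing, hence a delay meets finitely many regions;
    the induction is on the rank left below [12 * M + 8]. [P] stands for satisfaction of the
    invariant, known along the delay. *)
Lemma region_succ_complete (P : region -> Prop) rx ry x y r t :
  in_region x y r -> 0 <= t ->
  (forall u s, 0 <= u <= t -> in_region (x + u * rx%:R) (y + u * ry%:R) s -> P s) ->
  exists2 k, in_region (x + t * rx%:R) (y + t * ry%:R) (iter k (region_succ rx ry) r)
    & forall j, (j <= k)%N -> P (iter j (region_succ rx ry) r).
Proof.
have [n] := ubnP (12 * M + 8 - region_rank rx ry r).
elim: n x y r t => // n IHn x y [[a b] o] t; rewrite ltnS => le_n Hr t0 HP.
have P0 : P (a, b, o) by apply: (HP 0); rewrite ?lexx // !mul0r !addr0.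
have stop : in_region (x + t * rx%:R) (y + t * ry%:R) (a, b, o) ->
    exists2 k, in_region (x + t * rx%:R) (y + t * ry%:R)
                 (iter k (region_succ rx ry) (a, b, o))
    & forall j, (j <= k)%N -> P (iter j (region_succ rx ry) (a, b, o)).
  by move=> Ht; exists 0; rewrite // => j; rewrite leqn0 => /eqP->.
have [mv|st] := boolP (rx && ~~ capped a || ry && ~~ capped b); last first.
  by apply: stop; apply: region_stuck.
(* If the successor is met at time [u], the remaining delay [t - u] is handled by the induction
   hypothesis from the point reached. *)
have go u : 0 <= u <= t ->
    in_region (x + u * rx%:R) (y + u * ry%:R) (region_succ rx ry (a, b, o)) ->
    exists2 k, in_region (x + t * rx%:R) (y + t * ry%:R)
                 (iter k (region_succ rx ry) (a, b, o))
    & forall j, (j <= k)%N -> P (iter j (region_succ rx ry) (a, b, o)).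
  case/andP=> u0 ut Hu.
  have := region_rank_succ (in_region_order Hr) mv.
  have := region_rank_le rx ry Hu => le_s lt_r.
  have shift z e : z + u * e + (t - u) * e = z + t * e by ring.
  have [||v s /andP[v0 vt]|k Hk Pk] := IHn _ _ _ (t - u) _ Hu.
  - by apply: leq_trans le_n; lia.
  - by rewrite subr_ge0.
  - rewrite -!addrA -!mulrDl; apply: HP.
    by rewrite addr_ge0 //= -lerBrDl.
  exists k.+1; first by rewrite iterSr -!shift.
  by case=> // j lejk; rewrite iterSr; apply: Pk.
have [d d0 [[H Hd]|H]] := region_crossing Hr mv.
- have [dt|td] := leP d t; first by apply: (go d); rewrite ?(ltW d0).
  by apply/stop/H; rewrite t0.
- move: t0; rewrite le_eqVlt => /predU1P[t0|t0].
    by apply: stop; rewrite -t0 !mul0r !addr0.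
  (* The successor is entered right after time 0, and this positive time lies within both the
     crossing and the delay. *)
  apply: (go (Num.min d t)); first by rewrite le_min ge_min lexx orbT !ltW.
  by apply: H; rewrite lt_min d0 t0 ge_min lexx.
Qed.

End Regions.

(** * The region graph *)

(** Coordinates are nonnegative, so a negative constant lies strictly below all of them. For
    [k <= M], a point or interval starting at [a.1] lies below [k] exactly when [a.1 < k]. *)
Definition coord_compare (op : comparison_op) (a : coord) (c : int) : bool :=
  let lt := if c is Posz k then a.1 < k else false in
  let eq := if c is Posz k then ~~ a.2 && (a.1 == k) else false in
  match op with
  | OpLt => lt
  | OpLe => lt || eq
  | OpEq => eq
  | OpGt => ~~ (lt || eq)
  | OpGe => ~~ lt
  end.

Definition region_sat (r : region) (g : rect 2) : bool :=
  all (fun k => coord_compare (cop k)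
                  (if cvar k == ord0 then r.1.1 else r.1.2) (cbound k)) g.

Definition region_reset (r : region) (X : {set 'I_2}) : region :=
  let: (a, b, o) := r in
  (if ord0 \in X then (0, false) else a,
   if ord_max \in X then (0, false) else b,
   if (ord0 \in X) || (ord_max \in X) then (false, false) else o).

Definition region0 : region := ((0, false), (0, false), (false, false)).

Definition rect_bounded (M : nat) (g : rect 2) : bool :=
  all (fun k => `|cbound k| <= M) g.

Lemma ord2P (i : 'I_2) : i = ord0 \/ i = ord_max.
Proof. by case: i => [[|[|//]] i2]; [left | right]; apply: val_inj. Qed.

(** * Constraints and resets depend only on regions *)

Section RegionSat.
Variables (M : nat) (R : realType).

Local Open Scope ring_scope.

Definition valuation_in (nu : 'rV[R]_2) (r : region) : Prop :=
  in_region M (nu 0 ord0) (nu 0 ord_max) r.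

Lemma coord_compareE op (x : R) a c :
  in_coord M x a -> (`|c| <= M)%N -> compare op x c%:~R = coord_compare op a c.
Proof.
move=> Ha leM.
have [lt eq] : x < c%:~R = (if c is Posz k then a.1 < k else false)%N /\
    (x == c%:~R) = (if c is Posz k then ~~ a.2 && (a.1 == k) else false).
  case: c leM => k /= kM.
    rewrite -pmulrn; case: Ha => [m mM ->|m mM mx xm|Mx] /=.
    - by rewrite ltr_nat eqr_nat.
    - have [mk|km] := ltnP m k.
        have : m.+1%:R <= k%:R :> R by rewrite ler_nat.
        rewrite -natr1 => /(lt_le_trans xm) xk.
        by rewrite xk lt_eqF.
      have /le_lt_trans/(_ mx) kx : k%:R <= m%:R :> R by rewrite ler_nat.
      by rewrite ltNge (ltW kx) gt_eqF.
    - have /le_lt_trans/(_ Mx) kx : k%:R <= M%:R :> R by rewrite ler_nat.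
      by rewrite ltNge (ltW kx) gt_eqF // ltnNge kM.
  have x0 : 0 <= x.
    by case: Ha => [m _ ->|m _ /ltW mx _|/ltW Mx]; first exact: ler0n;
      [apply: le_trans mx | apply: le_trans Mx].
  have cx : (Negz k)%:~R < x.
    by apply: lt_le_trans x0; rewrite ltrz0.
  by split; [apply/negbTE; rewrite -leNgt ltW | rewrite gt_eqF].
case: op => //=.
- by rewrite le_eqVlt eq lt orbC.
- by rewrite ltNge le_eqVlt eq lt orbC.
- by rewrite leNgt lt.
Qed.

Lemma region_satE nu r g :
  valuation_in nu r -> rect_bounded M g -> sat nu g = region_sat r g.
Proof.
case: r => [[a b] o] [Ha Hb _]; elim: g => //= k g IHg /andP[kM /IHg->].
by congr (_ && _); case: (ord2P (cvar k)) => -> /=; apply: coord_compareE.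
Qed.

Lemma valuation_in_reset nu r X :
  valuation_in nu r -> valuation_in (reset nu X) (region_reset r X).
Proof.
have z : in_coord M (0 : R) (0, false) by apply: in_coord_int.
case: r => [[a b] o] [Ha Hb Ho]; rewrite /valuation_in /= !mxE.
by split; case: (ord0 \in X); case: (ord_max \in X); rewrite //= andbF.
Qed.

Lemma valuation_in0 : valuation_in 0 region0.
Proof. by rewrite /valuation_in /region0 !mxE; split=> //; apply: in_coord_int. Qed.

End RegionSat.

Lemma List_InP (T : eqType) (x : T) s : List.In x s <-> x \in s.
Proof.
elim: s => // y s IHs; rewrite inE /=; split.
  by case=> [->|/IHs->]; rewrite ?eqxx ?orbT.
by case/predU1P=> [->|/IHs]; [left | right].
Qed.

(** States are collected in this shape because folds on trees mirror it; only membership matters,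
    neither order nor repetition. *)
Lemma mem_foldl_catrev (S : eqType) (T : Type) (f : T -> seq S) s acc l :
  s \in foldl (fun acc x => catrev (f x) acc) acc l <->
  s \in acc \/ exists2 x, List.In x l & s \in f x.
Proof.
elim: l acc => [|x l IHl] acc /=.
  by split=> [|[|[]]] //; left.
rewrite IHl catrevE mem_cat mem_rev; split.
  case=> [/orP[sx|]|[y ly sy]]; [|by left|].
    by right; exists x => //; left.
  by right; exists y => //; right.
case=> [->|[y [<- ->|ly sy]]]; [by left; rewrite orbT | by left|].
by right; exists y.
Qed.

(** * Bounded exploration of the region graph *)

Section Exploration.
Variables (M : nat) (H : singular_automaton 2).

Definition state : Type := mode H * region.

(** An edge stands for a single crossing; longer delays are paths. Testing a rate against 0 is
    faithful for stopwatches. *)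
Definition delays (s : state) : seq state :=
  let: (q, r) := s in
  let r' := region_succ M (rate q ord0 ord0 != 0%R) (rate q ord0 ord_max != 0%R) r in
  if region_sat r (invariant q) && region_sat r' (invariant q)
  then [:: (q, r')] else [::].

Definition jumps (s : state) (e : transition 2 (mode H) (action H)) : seq state :=
  let: (q, r) := s in
  let r' := region_reset r (resets e) in
  if [&& source e == q, region_sat r (guard e)
       & region_sat r' (invariant (target e))]
  then [:: (target e, r')] else [::].

Definition successors (s : state) : seq state :=
  foldl (fun acc e => catrev (jumps s e) acc) (delays s) (transitions H).

(** Earlier states are kept, so that [n] iterations collect the ends of all paths of length at most
    [n]. Duplicates affect only the running time. *)
Definition explore (l : seq state) : seq state :=
  foldl (fun acc s => catrev (successors s) acc) l l.

Definition initial_states : seq state :=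
  foldl (fun acc q => catrev (if region_sat region0 (invariant q)
                              then [:: (q, region0)] else [::]) acc)
    [::] (enum (initial H)).

(* There are at most [#|mode H| * (M + 1)^2 * 16] states. *)
Definition search : seq state :=
  iter #|mode H| (iter M.+1 (iter M.+1 (iter 16 explore))) initial_states.

Definition edge : rel state := fun s s' => s' \in successors s.

Lemma mem_explore s l :
  s \in explore l <-> s \in l \/ exists2 s0, s0 \in l & edge s0 s.
Proof.
rewrite mem_foldl_catrev; split=> -[|[s0]]; [by left| |by left|];
  by move=> /List_InP l0 e0; right; exists s0.
Qed.

Lemma mem_iter_explore n s l :
  s \in iter n explore l <->
  exists s0 p, [/\ s0 \in l, path edge s0 p, last s0 p = s & size p <= n].
Proof.
elim: n s => [|n IHn] s; split.
- by exists s, [::].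
- by case=> s0 [[|a p] [l0 _ /= <- //]].
- rewrite iterS mem_explore => -[/IHn[s0 [p [l0 ep lp le_n]]]|].
    by exists s0, p; split=> //; apply: leqW.
  case=> s1 /IHn[s0 [p [l0 ep lp le_n]]] e1.
  exists s0, (rcons p s); rewrite rcons_path last_rcons size_rcons lp.
  by split; rewrite // ep.
- case=> s0 [p]; case: (lastP p) => [|{}p s'] [l0 ep lp le_n].
    by rewrite iterS mem_explore; left; apply/IHn; exists s0, [::].
  move: ep lp le_n; rewrite rcons_path last_rcons size_rcons iterS.
  move=> /andP[ep es] <- le_n; rewrite mem_explore; right.
  by exists (last s0 p) => //; apply/IHn; exists s0, p.
Qed.

Lemma iterM (T : Type) (f : T -> T) m n x : iter m (iter n f) x = iter (m * n) f x.
Proof. by elim: m => //= m ->; rewrite mulSn iterD. Qed.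

Lemma mem_search s :
  s \in search <-> exists s0 p, [/\ s0 \in initial_states, path edge s0 p,
    last s0 p = s & size p <= #|mode H| * (M.+1 * (M.+1 * 16))].
Proof.
rewrite -mem_iter_explore -iterM /search.
have e3 : iter M.+1 (iter M.+1 (iter 16 explore))
    =1 iter (M.+1 * (M.+1 * 16)) explore.
  move=> l; rewrite -iterM; apply: eq_iter => {}l.
  exact: iterM.
by rewrite (eq_iter e3).
Qed.

(** Some of these tuples denote empty regions; the list serves to bound the number of states. *)
Definition regions : seq region :=
  let bools := [:: true; false] in
  let coords := [seq (m, b) | m <- iota 0 M.+1, b <- bools] in
  [seq (ab, o) | ab <- [seq (a, b) | a <- coords, b <- coords],
                 o <- [seq (l, g) | l <- bools, g <- bools]].

Lemma size_regions : size regions = M.+1 * (M.+1 * 16).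
Proof. by rewrite !size_allpairs size_iota /=; lia. Qed.

Lemma mem_regions (R : realType) (nu : 'rV[R]_2) r :
  valuation_in M nu r -> r \in regions.
Proof.
case: r => [[[m a] [n b]] [l g]] [/in_coord_le mM /in_coord_le nM _].
have memb (c : bool) : c \in [:: true; false] by case: c.
by do ![apply: allpairs_f]; rewrite ?mem_iota.
Qed.

(** * Correspondence between runs and paths *)

Variable R : realType.
Hypothesis stopwatchH : stopwatch_automaton H.
Hypothesis guard_bounded :
  forall e, List.In e (transitions H) -> rect_bounded M (guard e).
Hypothesis invariant_bounded : forall q : mode H, rect_bounded M (invariant q).

Local Notation runs := (clos_refl_trans (config R H) (@step R 2 H)).

Lemma elapseE (q : mode H) (nu : 'rV[R]_2) t i :
  (elapse q nu t ord0 i = nu ord0 i + t * (rate q ord0 i != 0)%:R)%R.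
Proof.
rewrite !mxE; case: (stopwatchH q i) => ->; rewrite ?eqxx ?oner_eq0.
  by rewrite rmorph0.
by rewrite rmorph1.
Qed.

(** The run starts from an arbitrary valuation of the source region, which allows edges to be
    chained. *)
Lemma edge_sound s s' (nu : 'rV[R]_2) :
  edge s s' -> valuation_in M nu s.2 ->
  exists2 nu', runs (s.1, nu) (s'.1, nu') & valuation_in M nu' s'.2.
Proof.
case: s => q r; rewrite /edge mem_foldl_catrev => -[|[e eH]] /=.
  case: ifP => // /andP[sr sr']; rewrite inE => /eqP-> Hr.
  have [t [t0 Ht Hu]] := @region_succ_sound M R (rate q ord0 ord0 != 0%R)
    (rate q ord0 ord_max != 0%R) _ _ _ Hr.
  exists (elapse q nu t); last by rewrite /valuation_in !elapseE.
  apply: rt_step => /=; apply: Delay => // u /Hu Hu'; move: sr sr'.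
  by case: Hu' => Hu'; [move=> sr _ | move=> _ sr]; move: sr;
     rewrite -(@region_satE M R (elapse q nu u)) // /valuation_in !elapseE.
case: ifP => // /and3P[/eqP<- sg si]; rewrite inE => /eqP-> Hr.
have Hr' := valuation_in_reset (resets e) Hr.
exists (reset nu (resets e)) => //; apply: rt_step => /=; apply: Jump => //.
- by rewrite (region_satE Hr) //; apply: guard_bounded.
- by rewrite (region_satE Hr').
Qed.

Lemma path_sound s p (nu : 'rV[R]_2) :
  path edge s p -> valuation_in M nu s.2 ->
  exists2 nu', runs (s.1, nu) ((last s p).1, nu')
             & valuation_in M nu' (last s p).2.
Proof.
elim: p s nu => [|s' p IHp] s nu /=; first by exists nu => //; apply: rt_refl.
case/andP=> es /IHp{}IHp /(edge_sound es)[nu1 run1 /IHp[nu2 run2 H2]].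
by exists nu2 => //; apply: rt_trans run1 run2.
Qed.

(** A jump is one edge, and a delay gives one edge per application of [region_succ]. *)
Lemma step_complete (c c' : config R H) r :
  step c c' -> valuation_in M c.2 r ->
  exists p, path edge (c.1, r) p /\
    exists2 r', last (c.1, r) p = (c'.1, r') & valuation_in M c'.2 r'.
Proof.
case=> [q nu t t0 Hsat|e nu eH sg si] /= Hr; last first.
  have Hr' := valuation_in_reset (resets e) Hr.
  exists [:: (target e, region_reset r (resets e))]; split; last first.
    by exists (region_reset r (resets e)).
  rewrite /= andbT /edge mem_foldl_catrev; right; exists e => //=.
  rewrite eqxx -(region_satE Hr) ?sg; last exact: guard_bounded.
  by rewrite -(region_satE Hr') // si mem_head.
set rx := (rate q ord0 ord0 != 0%R); set ry := (rate q ord0 ord_max != 0%R).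
pose P s := region_sat s (invariant q).
have [|k Hk Pk] := @region_succ_complete M R P rx ry _ _ _ t Hr t0.
  move=> u s ut Hs.
  rewrite /P -(@region_satE M R (elapse q nu u)) //; first exact: Hsat.
  by rewrite /valuation_in !elapseE.
suffices [p [ep lp]] : exists p, path edge (q, r) p /\
    last (q, r) p = (q, iter k (region_succ M rx ry) r).
  exists p; split=> //; exists (iter k (region_succ M rx ry) r) => //.
  by rewrite /valuation_in !elapseE.
elim: k {Hk} Pk => [|k IHk] Pk; first by exists [::].
have [j jk|p [ep lp]] := IHk; first by apply: Pk; apply: leqW.
exists (rcons p (q, iter k.+1 (region_succ M rx ry) r)).
rewrite rcons_path last_rcons ep lp; split=> //=.
rewrite /edge mem_foldl_catrev; left => /=.
move: (Pk k (leqnSn k)) (Pk k.+1 (leqnn _)); rewrite /P /= => -> ->.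
exact: mem_head.
Qed.

Lemma runs_complete (c c' : config R H) r :
  runs c c' -> valuation_in M c.2 r ->
  exists p, path edge (c.1, r) p /\
    exists2 r', last (c.1, r) p = (c'.1, r') & valuation_in M c'.2 r'.
Proof.
move=> run; elim: run r => {c c'} [c c' st|c|c1 c2 c3 _ IH1 _ IH2] r Hr.
- exact: step_complete st Hr.
- by exists [::]; split=> //; exists r.
have [p1 [ep1 [r1 lp1 Hr1]]] := IH1 r Hr.
have [p2 [ep2 [r2 lp2 Hr2]]] := IH2 r1 Hr1.
exists (p1 ++ p2); rewrite cat_path last_cat lp1 ep1; split=> //.
by exists r2.
Qed.

Lemma mem_initial_states s :
  s \in initial_states <->
  [/\ s.1 \in initial H, region_sat region0 (invariant s.1) & s.2 = region0].
Proof.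
rewrite mem_foldl_catrev; split.
  case=> // -[q /List_InP]; rewrite mem_enum => qH.
  by case: ifP => // sat; rewrite inE => /eqP->.
case: s => q r /= [qH sat ->]; right; exists q.
  by apply/List_InP; rewrite mem_enum.
by rewrite sat mem_head.
Qed.

Lemma searchP (F : {set mode H}) :
  has (fun s => s.1 \in F) search <-> reachable R F.
Proof.
split.
  case/hasP=> s /mem_search[s0 [p [/mem_initial_states[q0H sat0 r0] ep lp _]]] sF.
  have H0 : valuation_in M (0 : 'rV[R]_2) s0.2 by rewrite r0; apply: valuation_in0.
  have [nu run _] := path_sound ep H0.
  exists s0.1, s.1, nu; split=> //; last by rewrite -lp.
  by rewrite (region_satE H0) ?r0.
case=> q0 [q [nu [q0H sat0 qF run]]].
have H0 : valuation_in M (0 : 'rV[R]_2) region0 by apply: valuation_in0.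
have [p [ep [r lp Hr]]] := runs_complete run H0.
apply/hasP; exists (q, r) => //; apply/mem_search.
(* A path without repeated states is no longer than the number of states, hence within the depth of
   [search]. *)
rewrite /= -lp; case/shortenP: ep => p' ep' up' _ {p lp}.
exists (q0, region0), p'; split=> //.
  by apply/mem_initial_states; split; rewrite //= -(region_satE H0).
(* By soundness, each prefix of the path has its last state realized by a valuation, so the region
   of that state is listed in [regions]. *)
have sub : {subset p' <= [seq (q, r) | q <- enum (mode H), r <- regions]}.
  move=> s /splitPr sp; case: sp ep' => p1 p2.
  rewrite -cat_rcons cat_path => /andP[ep1 _].
  have [nu' _] := path_sound ep1 H0; rewrite last_rcons => /mem_regions Hs.
  by case: s Hs {ep1} => q' r' Hs; apply: allpairs_f; rewrite // mem_enum.
move: up' => /andP[_ /uniq_leq_size/(_ sub)].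
by rewrite size_allpairs size_regions -cardE.
Qed.

End Exploration.

(** * Exploration on trees *)

Create HintDb computability discriminated.
#[local] Hint Constants Opaque : computability.
#[local] Hint Resolve computable_id computable_const computable_hd computable_tl
  computable_Cons computable_eqt computable_ift computable_foldt : computability.
(* Unification eta-contracts [fun x => tl x]. *)
#[local] Hint Extern 0 (computable hd) => exact (computable_hd computable_id)
  : computability.
#[local] Hint Extern 0 (computable tl) => exact (computable_tl computable_id)
  : computability.
#[local] Hint Extern 5 (computable (fun x => ?f _)) =>
  lazymatch goal with H : computable f |- _ => apply: (computable_comp H) end
  : computability.
Ltac computability := intros; typeclasses eauto with computability.

Local Notation tree1 := (Cons Nil Nil).

(** * Booleans, lists and unary numerals on trees *)

Definition nott (a : tree) : tree := ift a Nil tree1.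
Definition andt (a b : tree) : tree := ift a b Nil.
Definition ort (a b : tree) : tree := ift a tree1 b.
Definition dropt (l k : tree) : tree := foldt (fun a _ => tl a) l k.
Definition catrevt (l a : tree) : tree := foldt (fun a e => Cons e a) a l.
Definition memt (x l : tree) : tree := foldt (fun a y => ort (eqt x y) a) Nil l.
(** Removing [m] units from the numeral [k] leaves something exactly when [m < k]. *)
Definition ltt (m k : tree) : tree := ift (dropt k m) tree1 Nil.

Lemma computable_nott f : computable f -> computable (fun x => nott (f x)).
Proof. rewrite /nott; computability. Qed.

Lemma computable_andt f g :
  computable f -> computable g -> computable (fun x => andt (f x) (g x)).
Proof. rewrite /andt; computability. Qed.

Lemma computable_ort f g :
  computable f -> computable g -> computable (fun x => ort (f x) (g x)).
Proof. rewrite /ort; computability. Qed.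
#[local] Hint Resolve computable_nott computable_andt computable_ort : computability.

Lemma computable_dropt f g :
  computable f -> computable g -> computable (fun x => dropt (f x) (g x)).
Proof. rewrite /dropt; computability. Qed.

Lemma computable_catrevt f g :
  computable f -> computable g -> computable (fun x => catrevt (f x) (g x)).
Proof. rewrite /catrevt; computability. Qed.

Lemma computable_memt f g :
  computable f -> computable g -> computable (fun x => memt (f x) (g x)).
Proof. rewrite /memt; computability. Qed.
#[local] Hint Resolve computable_dropt computable_catrevt computable_memt
  : computability.

Lemma computable_ltt f g :
  computable f -> computable g -> computable (fun x => ltt (f x) (g x)).
Proof. rewrite /ltt; computability. Qed.
#[local] Hint Resolve computable_ltt : computability.

(** * Regions on trees *)

Definition x_coord (r : tree) : tree := hd (hd r).
Definition y_coord (r : tree) : tree := tl (hd r).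
Definition lt_bit (r : tree) : tree := hd (tl r).
Definition gt_bit (r : tree) : tree := tl (tl r).

Lemma computable_x_coord f : computable f -> computable (fun x => x_coord (f x)).
Proof. rewrite /x_coord; computability. Qed.

Lemma computable_y_coord f : computable f -> computable (fun x => y_coord (f x)).
Proof. rewrite /y_coord; computability. Qed.

Lemma computable_lt_bit f : computable f -> computable (fun x => lt_bit (f x)).
Proof. rewrite /lt_bit; computability. Qed.

Lemma computable_gt_bit f : computable f -> computable (fun x => gt_bit (f x)).
Proof. rewrite /gt_bit; computability. Qed.
#[local] Hint Resolve computable_x_coord computable_y_coord
  computable_lt_bit computable_gt_bit : computability.

(** [Cons tree1 M] is the code of the coordinate [(M, true)]. *)
Definition cappedt (M a : tree) : tree := eqt a (Cons tree1 M).
Definition fractionalt (M a : tree) : tree := andt (hd a) (nott (cappedt M a)).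
Definition tickt (a : tree) : tree :=
  ift (hd a) (Cons Nil (Cons Nil (tl a))) (Cons tree1 (tl a)).
Definition movet (M rx a : tree) : tree := andt rx (nott (cappedt M a)).
Definition relt (M a b : tree) : tree := andt (fractionalt M a) (fractionalt M b).

Lemma computable_cappedt f g : computable f -> computable g ->
  computable (fun x => cappedt (f x) (g x)).
Proof. rewrite /cappedt; computability. Qed.
#[local] Hint Resolve computable_cappedt : computability.

Lemma computable_fractionalt f g : computable f -> computable g ->
  computable (fun x => fractionalt (f x) (g x)).
Proof. rewrite /fractionalt; computability. Qed.

Lemma computable_tickt f : computable f -> computable (fun x => tickt (f x)).
Proof. rewrite /tickt; computability. Qed.

Lemma computable_movet f g h : computable f -> computable g -> computable h ->
  computable (fun x => movet (f x) (g x) (h x)).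
Proof. rewrite /movet; computability. Qed.
#[local] Hint Resolve computable_fractionalt computable_tickt computable_movet
  : computability.

Lemma computable_relt f g h : computable f -> computable g -> computable h ->
  computable (fun x => relt (f x) (g x) (h x)).
Proof. rewrite /relt; computability. Qed.
#[local] Hint Resolve computable_relt : computability.

(** This is [jx] of [region_succ]; exchanging the coordinates gives [jy]. *)
Definition jumpt (M rx ry a b l g : tree) : tree :=
  andt (movet M rx a)
    (ift (movet M ry b) (ort (nott (hd a)) (andt (hd b) (nott l)))
       (ort (nott (relt M a b)) g)).

Lemma computable_jumpt fM frx fry fa fb fl fg :
  computable fM -> computable frx -> computable fry ->
  computable fa -> computable fb -> computable fl -> computable fg ->
  computable (fun x => jumpt (fM x) (frx x) (fry x) (fa x) (fb x) (fl x) (fg x)).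
Proof. rewrite /jumpt; computability. Qed.
#[local] Hint Resolve computable_jumpt : computability.

Definition region_succt (M rx ry r : tree) : tree :=
  let a := x_coord r in let b := y_coord r in
  let l := lt_bit r in let g := gt_bit r in
  let jx := jumpt M rx ry a b l g in
  let jy := jumpt M ry rx b a g l in
  let a' := ift jx (tickt a) a in
  let b' := ift jy (tickt b) b in
  let mx := movet M rx a in let my := movet M ry b in
  Cons (Cons a' b')
    (ift (ort jx jy)
       (ift (relt M a' b') (Cons (andt jx (nott jy)) (andt jy (nott jx)))
          (Cons Nil Nil))
       (ift (ort mx my) (Cons (andt my (nott g)) (andt mx (nott l)))
          (Cons l g))).

Lemma computable_region_succt fM frx fry fr :
  computable fM -> computable frx -> computable fry -> computable fr ->
  computable (fun x => region_succt (fM x) (frx x) (fry x) (fr x)).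
Proof. rewrite /region_succt /=; computability. Qed.
#[local] Hint Resolve computable_region_succt : computability.

(** Operators are numbered in unary, so testing successive tails of [op] selects one. [hd c] tells
    whether the constant is negative. *)
Definition coord_comparet (op a c : tree) : tree :=
  let lt := ift (hd c) Nil (ltt (tl a) (tl c)) in
  let eq := ift (hd c) Nil (andt (nott (hd a)) (eqt (tl a) (tl c))) in
  let le := ort lt eq in
  ift op
    (ift (tl op)
       (ift (tl (tl op)) (ift (tl (tl (tl op))) (nott lt) (nott le)) eq)
       le)
    lt.

Lemma computable_coord_comparet f g h :
  computable f -> computable g -> computable h ->
  computable (fun x => coord_comparet (f x) (g x) (h x)).
Proof. rewrite /coord_comparet /=; computability. Qed.
#[local] Hint Resolve computable_coord_comparet : computability.

Definition region_satt (r g : tree) : tree :=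
  foldt (fun acc k => andt (coord_comparet (hd (tl k))
                              (ift (hd k) (y_coord r) (x_coord r))
                              (hd (tl (tl k)))) acc) tree1 g.

Lemma computable_region_satt f g : computable f -> computable g ->
  computable (fun x => region_satt (f x) (g x)).
Proof. rewrite /region_satt; computability. Qed.
#[local] Hint Resolve computable_region_satt : computability.

(** [tree1] has three readings here: the rank 1 of the second variable, the coordinate [(0, false)]
    and the order [(false, false)]. *)
Definition region_resett (r X : tree) : tree :=
  let x0 := memt Nil X in let y0 := memt tree1 X in
  Cons (Cons (ift x0 tree1 (x_coord r)) (ift y0 tree1 (y_coord r)))
    (ift (ort x0 y0) tree1 (tl r)).

Lemma computable_region_resett f g : computable f -> computable g ->
  computable (fun x => region_resett (f x) (g x)).
Proof. rewrite /region_resett /=; computability. Qed.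
#[local] Hint Resolve computable_region_resett : computability.

(** * Automata and their exploration on trees *)

Definition ntht (l k : tree) : tree := hd (dropt l k).
(** The chains of [hd] and [tl] follow the order of the fields in [automaton_tree]. *)
Definition transitionst (A : tree) : tree := hd (tl (tl (tl (tl A)))).
Definition invariantt (A k : tree) : tree :=
  ntht (hd (tl (tl (tl (tl (tl A)))))) k.
Definition ratet (A k : tree) : tree :=
  ntht (hd (tl (tl (tl (tl (tl (tl A))))))) k.
(** [tl (hd r)] is the absolute value of the numerator in unary, hence [Nil] only for 0. *)
Definition rat_neq0 (r : tree) : tree := ift (tl (hd r)) tree1 Nil.

Lemma computable_transitionst f :
  computable f -> computable (fun x => transitionst (f x)).
Proof. rewrite /transitionst; computability. Qed.

Lemma computable_invariantt f g : computable f -> computable g ->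
  computable (fun x => invariantt (f x) (g x)).
Proof. rewrite /invariantt /ntht; computability. Qed.

Lemma computable_ratet f g : computable f -> computable g ->
  computable (fun x => ratet (f x) (g x)).
Proof. rewrite /ratet /ntht; computability. Qed.

Lemma computable_rat_neq0 f : computable f -> computable (fun x => rat_neq0 (f x)).
Proof. rewrite /rat_neq0; computability. Qed.
#[local] Hint Resolve computable_transitionst computable_invariantt
  computable_ratet computable_rat_neq0 : computability.

Definition delayst (M A s : tree) : tree :=
  let k := hd s in let r := tl s in
  let v := ratet A k in
  let r' := region_succt M (rat_neq0 (hd v)) (rat_neq0 (hd (tl v))) r in
  let inv := invariantt A k in
  ift (andt (region_satt r inv) (region_satt r' inv)) (Cons (Cons k r') Nil) Nil.

Lemma computable_delayst f g h :
  computable f -> computable g -> computable h ->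
  computable (fun x => delayst (f x) (g x) (h x)).
Proof. rewrite /delayst /=; computability. Qed.

Definition jumpst (A s e : tree) : tree :=
  let r' := region_resett (tl s) (hd (tl (tl (tl e)))) in
  let k' := hd (tl (tl (tl (tl e)))) in
  ift (andt (eqt (hd e) (hd s))
         (andt (region_satt (tl s) (hd (tl e))) (region_satt r' (invariantt A k'))))
    (Cons (Cons k' r') Nil) Nil.

Lemma computable_jumpst f g h :
  computable f -> computable g -> computable h ->
  computable (fun x => jumpst (f x) (g x) (h x)).
Proof. rewrite /jumpst /=; computability. Qed.
#[local] Hint Resolve computable_delayst computable_jumpst : computability.

Definition successorst (M A s : tree) : tree :=
  foldt (fun acc e => catrevt (jumpst A s e) acc) (delayst M A s) (transitionst A).

Lemma computable_successorst f g h :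
  computable f -> computable g -> computable h ->
  computable (fun x => successorst (f x) (g x) (h x)).
Proof. rewrite /successorst; computability. Qed.
#[local] Hint Resolve computable_successorst : computability.

Definition exploret (M A l : tree) : tree :=
  foldt (fun acc s => catrevt (successorst M A s) acc) l l.

Lemma computable_exploret f g h :
  computable f -> computable g -> computable h ->
  computable (fun x => exploret (f x) (g x) (h x)).
Proof. rewrite /exploret; computability. Qed.
#[local] Hint Resolve computable_exploret : computability.

Definition coord_tree (a : coord) : tree := Cons (bool_tree a.2) (nat_tree a.1).

Definition region_tree (r : region) : tree :=
  Cons (Cons (coord_tree r.1.1) (coord_tree r.1.2))
    (Cons (bool_tree r.2.1) (bool_tree r.2.2)).

Definition initial_statest (A : tree) : tree :=
  foldt (fun acc k =>
           catrevt (ift (region_satt (region_tree region0) (invariantt A k))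
                      (Cons (Cons k (region_tree region0)) Nil) Nil) acc)
    Nil (hd (tl (tl A))).

Lemma computable_initial_statest f :
  computable f -> computable (fun x => initial_statest (f x)).
Proof. rewrite /initial_statest; computability. Qed.
#[local] Hint Resolve computable_initial_statest : computability.

(** Nesting folds over numerals avoids computing the product that bounds the number of states;
    [Cons Nil M] is the successor of [M] and [hd (tl A)] the number of modes. *)
Definition searcht (M A : tree) : tree :=
  foldt (fun l _ =>
    foldt (fun l _ =>
      foldt (fun l _ =>
        foldt (fun l _ => exploret M A l) l (nat_tree 16))
      l (Cons Nil M))
    l (Cons Nil M))
  (initial_statest A) (hd (tl A)).

Lemma computable_searcht f g :
  computable f -> computable g -> computable (fun x => searcht (f x) (g x)).
Proof. rewrite /searcht; computability. Qed.
#[local] Hint Resolve computable_searcht : computability.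

(** Absolute values of constants are added up rather than maximized: the sum is also a bound, and
    needs only [Cons]. *)
Definition rect_boundt (m g : tree) : tree :=
  foldt (fun m k => foldt (fun m _ => Cons Nil m) m (tl (hd (tl (tl k))))) m g.

Lemma computable_rect_boundt f g :
  computable f -> computable g -> computable (fun x => rect_boundt (f x) (g x)).
Proof. rewrite /rect_boundt; computability. Qed.
#[local] Hint Resolve computable_rect_boundt : computability.

Definition boundt (A : tree) : tree :=
  foldt rect_boundt
    (foldt (fun m e => rect_boundt m (hd (tl e))) Nil (transitionst A))
    (hd (tl (tl (tl (tl (tl A)))))).

Lemma computable_boundt f : computable f -> computable (fun x => boundt (f x)).
Proof. rewrite /boundt; computability. Qed.
#[local] Hint Resolve computable_boundt : computability.

Definition reachablet (i : tree) : tree :=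
  foldt (fun acc s => ort (memt (hd s) (tl i)) acc) Nil
    (searcht (boundt (hd i)) (hd i)).

Lemma computable_reachablet : computable reachablet.
Proof. rewrite /reachablet; computability. Qed.

(** * Correctness of the encoding *)

Lemma eq_treeP d e : reflect (d = e) (eq_tree d e).
Proof.
apply: (iffP idP) => [|<-].
  by elim: d e => [|a IHa b IHb] [|a' b'] //= /andP[/IHa-> /IHb->].
by elim: d => //= a -> b ->.
Qed.

Lemma eqt_inj (T : eqType) (f : T -> tree) x y :
  injective f -> eqt (f x) (f y) = bool_tree (x == y).
Proof. by move=> injf; congr bool_tree; apply/eq_treeP/eqP => [/injf|->]. Qed.

Lemma nat_tree_inj : injective nat_tree.
Proof. by elim=> [|m IHm] [|n] //= [/IHm->]. Qed.

Lemma elt_tree_inj (T : finType) : injective (@elt_tree T).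
Proof. by move=> x y /nat_tree_inj/ord_inj/enum_rank_inj. Qed.

Lemma bool_tree_inj : injective bool_tree.
Proof. by case=> [] []. Qed.

Lemma iftE b c d : ift (bool_tree b) c d = if b then c else d.
Proof. by case: b. Qed.

Lemma nottE b : nott (bool_tree b) = bool_tree (~~ b).
Proof. by case: b. Qed.

Lemma andtE b c : andt (bool_tree b) (bool_tree c) = bool_tree (b && c).
Proof. by case: b. Qed.

Lemma ortE b c : ort (bool_tree b) (bool_tree c) = bool_tree (b || c).
Proof. by case: b. Qed.

(** Transfer principle for all the programs below: if the body commutes with the encodings, so does
    the fold. *)
Lemma foldt_seq (S T : Type) (encS : S -> tree) (encT : T -> tree) F F' a l :
  (forall a x, F (encS a) (encT x) = encS (F' a x)) ->
  foldt F (encS a) (seq_tree encT l) = encS (foldl F' a l).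
Proof. by move=> FE; elim: l a => //= x l IHl a; rewrite FE IHl. Qed.

Lemma foldt_nat (S : Type) (enc : S -> tree) F F' a k :
  (forall a, F (enc a) Nil = enc (F' a)) ->
  foldt F (enc a) (nat_tree k) = enc (iter k F' a).
Proof. by move=> FE; elim: k a => //= k IHk a; rewrite FE IHk -iterSr. Qed.

Lemma dropt_seq (T : Type) (f : T -> tree) l k :
  dropt (seq_tree f l) (nat_tree k) = seq_tree f (drop k l).
Proof.
elim: k l => [|k IHk] l; first by rewrite drop0.
by case: l => [|x l]; [exact: (IHk [::]) | exact: (IHk l)].
Qed.

Lemma dropt_nat m k : dropt (nat_tree m) (nat_tree k) = nat_tree (m - k).
Proof.
elim: k m => [|k IHk] m; first by rewrite subn0.
by case: m => [|m]; [exact: (IHk 0) | exact: (IHk m)].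
Qed.

Lemma lttE m k : ltt (nat_tree m) (nat_tree k) = bool_tree (m < k).
Proof. by rewrite /ltt dropt_nat -subn_gt0; case: (k - m). Qed.

Lemma catrevtE (T : Type) (f : T -> tree) l a :
  catrevt (seq_tree f l) (seq_tree f a) = seq_tree f (catrev l a).
Proof. by elim: l a => //= x l IHl a; rewrite -IHl. Qed.

Lemma memtE (T : eqType) (f : T -> tree) x l :
  injective f -> memt (f x) (seq_tree f l) = bool_tree (x \in l).
Proof.
move=> injf; rewrite /memt -[Nil]/(bool_tree false).
rewrite (@foldt_seq _ _ _ _ _ (fun a y => (x == y) || a)); last first.
  by move=> a y; rewrite eqt_inj // ortE.
congr bool_tree; rewrite -[x \in l]orbF.
by elim: l false => //= y l IHl a; rewrite IHl inE orbCA orbA.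
Qed.

Lemma ntht_map (T : finType) (U : Type) (f : U -> tree) (g : T -> U) x :
  ntht (map_tree f g) (elt_tree x) = f (g x).
Proof.
(* The default [x] is harmless: the rank of [x] is below the length of the enumeration. *)
rewrite /ntht /map_tree /elt_tree dropt_seq (drop_nth x) -?cardE //=.
by rewrite nth_enum_rank.
Qed.

Lemma elt_tree_ord n (i : 'I_n) : elt_tree i = nat_tree i.
Proof. by rewrite /elt_tree enum_rank_ord. Qed.

(** * The encoding commutes with region operations and exploration *)

Section Encoding.
Variable M : nat.
Local Notation Mt := (nat_tree M).

Definition booltE := (iftE, nottE, andtE, ortE).

Lemma coord_tree_inj : injective coord_tree.
Proof. by case=> m b [m' b'] [/bool_tree_inj/= -> /nat_tree_inj/= ->]. Qed.

Lemma cappedtE a : cappedt Mt (coord_tree a) = bool_tree (capped M a).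
Proof. exact: (eqt_inj a (M, true) coord_tree_inj). Qed.

Lemma movetE rx a : movet Mt (bool_tree rx) (coord_tree a)
  = bool_tree (rx && ~~ capped M a).
Proof. by rewrite /movet cappedtE !booltE. Qed.

Lemma tickE a : tickt (coord_tree a) = coord_tree (tick a).
Proof. by case: a => m []. Qed.

Lemma reltE a b : relt Mt (coord_tree a) (coord_tree b)
  = bool_tree (fractional M a && fractional M b).
Proof. by rewrite /relt /fractionalt !cappedtE !booltE. Qed.

Lemma jumptE rx ry a b l g :
  jumpt Mt (bool_tree rx) (bool_tree ry) (coord_tree a) (coord_tree b)
    (bool_tree l) (bool_tree g)
  = bool_tree (rx && ~~ capped M a &&
      (if ry && ~~ capped M b then ~~ a.2 || b.2 && ~~ l
       else ~~ (fractional M a && fractional M b) || g)).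
Proof. by rewrite /jumpt !movetE reltE !booltE -fun_if andtE. Qed.

Lemma region_succtE rx ry r :
  region_succt Mt (bool_tree rx) (bool_tree ry) (region_tree r)
  = region_tree (region_succ M rx ry r).
Proof.
case: r => [[a b] [l g]]; rewrite /region_succt /=.
rewrite /x_coord /y_coord /lt_bit /gt_bit /region_tree /=.
(* The second use of [jumpt] exchanges the coordinates, hence the conjunction to be commuted. *)
rewrite !movetE !jumptE !tickE [fractional M b && _]andbC !iftE -!fun_if reltE.
rewrite !booltE; set jx := _ && (if _ && ~~ capped M b then _ else _).
set jy := _ && (if _ && ~~ capped M a then _ else _).
by case: (jx || jy); [case: (_ && _) | case: (_ || _)].
Qed.

Lemma coord_comparetE op a c :
  coord_comparet (op_tree op) (coord_tree a) (int_tree c)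
  = bool_tree (coord_compare op a c).
Proof.
have [lt eq] :
    ift (hd (int_tree c)) Nil (ltt (tl (coord_tree a)) (tl (int_tree c)))
      = bool_tree (if c is Posz k then a.1 < k else false) /\
    ift (hd (int_tree c)) Nil (andt (nott (hd (coord_tree a)))
        (eqt (tl (coord_tree a)) (tl (int_tree c))))
      = bool_tree (if c is Posz k then ~~ a.2 && (a.1 == k) else false).
  case: c => k //=.
  by rewrite lttE nottE (eqt_inj _ _ nat_tree_inj) andtE.
by rewrite /coord_comparet lt eq !ortE !nottE; case: op.
Qed.

Lemma foldl_all (T : Type) (p : pred T) s :
  foldl (fun acc x => p x && acc) true s = all p s.
Proof.
rewrite -[all p s]andbT.
by elim: s true => //= x s IHs b; rewrite IHs andbA [p x && _]andbC.
Qed.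

Lemma region_sattE r g :
  region_satt (region_tree r) (rect_tree g) = bool_tree (region_sat r g).
Proof.
rewrite /region_satt -[tree1]/(bool_tree true) /region_sat -foldl_all.
apply: foldt_seq => acc k /=; rewrite elt_tree_ord -andtE -coord_comparetE.
by case: (ord2P (cvar k)) => ->.
Qed.

Lemma mem_set_tree (T : finType) (x : T) (A : {set T}) :
  memt (elt_tree x) (set_tree A) = bool_tree (x \in A).
Proof. by rewrite memtE ?mem_enum //; apply: elt_tree_inj. Qed.

Lemma region_resettE r X :
  region_resett (region_tree r) (set_tree X) = region_tree (region_reset r X).
Proof.
case: r => [[a b] o]; rewrite /region_resett /=.
have -> : memt Nil (set_tree X) = bool_tree (ord0 \in X).
  by rewrite -mem_set_tree elt_tree_ord.
have -> : memt tree1 (set_tree X) = bool_tree (ord_max \in X).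
  by rewrite -mem_set_tree elt_tree_ord.
by rewrite ortE !iftE; case: (ord0 \in X); case: (ord_max \in X).
Qed.

Lemma rat_neq0E (c : rat) : rat_neq0 (rat_tree c) = bool_tree (c != 0%R).
Proof. by rewrite /rat_neq0 /= -numq_eq0 -absz_eq0; case: `|numq c|. Qed.

Variable H : singular_automaton 2.
Local Notation A := (automaton_tree H).

Definition state_tree (s : state H) : tree :=
  Cons (elt_tree s.1) (region_tree s.2).

Lemma invarianttE (q : mode H) :
  invariantt A (elt_tree q) = rect_tree (invariant q).
Proof. exact: ntht_map. Qed.

Lemma ratetE (q : mode H) :
  ratet A (elt_tree q) = map_tree rat_tree (rate q ord0).
Proof. exact: (ntht_map _ (fun q => rate q)). Qed.

Lemma map_tree_ord2 (U : Type) (f : U -> tree) (g : 'I_2 -> U) :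
  map_tree f g = Cons (f (g ord0)) (Cons (f (g ord_max)) Nil).
Proof.
rewrite /map_tree enum_ordSl enum_ordSl enum_ord0 /=.
by have -> : lift ord0 ord0 = ord_max :> 'I_2 by apply: val_inj.
Qed.

Lemma delaystE s :
  delayst Mt A (state_tree s) = seq_tree state_tree (delays M s).
Proof.
case: s => q r; rewrite /delayst /= invarianttE ratetE map_tree_ord2 /=.
by rewrite !rat_neq0E region_succtE !region_sattE andtE iftE; case: ifP.
Qed.

Lemma jumpstE s (e : transition 2 (mode H) (action H)) :
  jumpst A (state_tree s) (transition_tree e) = seq_tree state_tree (jumps s e).
Proof.
case: s => q r; rewrite /jumpst /= invarianttE region_resettE !region_sattE.
by rewrite (eqt_inj _ _ (@elt_tree_inj _)) !andtE iftE; case: ifP.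
Qed.

Lemma successorstE s :
  successorst Mt A (state_tree s) = seq_tree state_tree (successors M s).
Proof.
rewrite /successorst delaystE; apply: foldt_seq => acc e.
by rewrite jumpstE catrevtE.
Qed.

Lemma exploretE l :
  exploret Mt A (seq_tree state_tree l) = seq_tree state_tree (explore M l).
Proof. by apply: foldt_seq => acc s; rewrite successorstE catrevtE. Qed.

Lemma initial_statestE :
  initial_statest A = seq_tree state_tree (initial_states H).
Proof.
rewrite /initial_statest /initial_states.
rewrite -[Nil in foldt _ Nil]/(seq_tree state_tree [::]).
apply: foldt_seq => acc q; rewrite invarianttE region_sattE iftE -catrevtE.
by case: ifP.
Qed.

Lemma searchtE : searcht Mt A = seq_tree state_tree (search M H).
Proof.
rewrite /searcht initial_statestE; apply: foldt_nat => l.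
(* [M.+1] is given explicitly so that [Cons Nil Mt] is recognized as its numeral by conversion. *)
do 2! [apply: (@foldt_nat _ (seq_tree state_tree) _ _ _ M.+1) => {}l].
by apply: foldt_nat => {}l; apply: exploretE.
Qed.

End Encoding.

(** * A bound on the constants of the automaton *)

Definition rect_bound (m : nat) (g : rect 2) : nat :=
  foldl (fun m k => `|cbound k| + m) m g.

Definition bound (H : singular_automaton 2) : nat :=
  foldl (fun m (q : mode H) => rect_bound m (invariant q))
    (foldl (fun m e => rect_bound m (guard e)) 0 (transitions H))
    (enum (mode H)).

Lemma rect_boundtE m g :
  rect_boundt (nat_tree m) (rect_tree g) = nat_tree (rect_bound m g).
Proof.
apply: foldt_seq => {}m k; rewrite (@foldt_nat _ nat_tree _ S) //.
by congr nat_tree; elim: `|cbound k| => //= n ->.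
Qed.

Lemma boundtE H : boundt (automaton_tree H) = nat_tree (bound H).
Proof.
rewrite /boundt /bound -[Nil]/(nat_tree 0).
rewrite (@foldt_seq _ _ nat_tree _ _ (fun m e => rect_bound m (guard e))).
  by apply: foldt_seq => m q; apply: rect_boundtE.
by move=> m e; apply: rect_boundtE.
Qed.

Lemma foldl_leq (T : Type) (f : nat -> T -> nat) m l :
  (forall m x, m <= f m x) -> m <= foldl f m l.
Proof. by move=> le_f; elim: l m => //= x l IHl m; apply: leq_trans (IHl _). Qed.

Lemma foldl_In_leq (T : Type) (f : nat -> T -> nat) m l x c :
  (forall m y, m <= f m y) -> (forall m, c <= f m x) -> List.In x l ->
  c <= foldl f m l.
Proof.
move=> le_f le_x; elim: l m => //= y l IHl m [->|/IHl//].
exact: leq_trans (foldl_leq _ _ le_f).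
Qed.

Lemma rect_bound_leq m g : m <= rect_bound m g.
Proof. by apply: foldl_leq => n k; apply: leq_addl. Qed.

Lemma rect_boundedP M (g : rect 2) :
  (forall k, List.In k g -> `|cbound k| <= M) -> rect_bounded M g.
Proof.
rewrite /rect_bounded; elim: g => //= k g IHg le_M; rewrite le_M; last by left.
by apply: IHg => k' gk'; apply: le_M; right.
Qed.

Lemma cbound_leq k (g : rect 2) m : List.In k g -> `|cbound k| <= rect_bound m g.
Proof.
by apply: foldl_In_leq => [n k'|n]; [apply: leq_addl | apply: leq_addr].
Qed.

Lemma guard_bounded H e :
  List.In e (transitions H) -> rect_bounded (bound H) (guard e).
Proof.
move=> eH; apply: rect_boundedP => k gk; rewrite /bound.
(* The fold over invariants starts from the bound for the guards and can only increase it. *)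
apply: leq_trans (foldl_leq _ _ _) => [|m q]; last exact: rect_bound_leq.
apply: foldl_In_leq eH => [m e'|m]; [exact: rect_bound_leq | exact: cbound_leq].
Qed.

Lemma invariant_bounded H (q : mode H) : rect_bounded (bound H) (invariant q).
Proof.
apply: rect_boundedP => k gk.
apply: (@foldl_In_leq _ _ _ _ q) => [m q'|m|].
- exact: rect_bound_leq.
- exact: cbound_leq.
- by apply/List_InP; rewrite mem_enum.
Qed.

Lemma reachabletE (I : reach_instance 2) :
  reachablet (instance_tree I)
  = bool_tree (has (fun s => s.1 \in final I)
                 (search (bound (automaton I)) (automaton I))).
Proof.
rewrite /reachablet /= boundtE searchtE -[Nil in LHS]/(bool_tree false).
rewrite (@foldt_seq _ _ _ _ _
           (fun b (s : state (automaton I)) => (s.1 \in final I) || b)).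
  congr bool_tree; rewrite -[RHS]orbF.
  by elim: (search _ _) false => //= s l IHl b; rewrite IHl orbCA orbA.
by move=> b s; rewrite mem_set_tree ortE.
Qed.

Theorem theorem6 (R : realType) :
  decidable_problem (@instance_tree 2)
    (fun I : reach_instance 2 => stopwatch_automaton (automaton I))
    (@reach_problem R 2).
Proof.
(* The program [c] is chosen before the instance; the bound [M] is computed by the program
   itself. *)
have [c cP] := computable_reachablet; exists c => I swI.
have [s run [out _]] := cP (update (fun=> Nil) 0 (instance_tree I)).
exists (has (fun s => s.1 \in final I)
         (search (bound (automaton I)) (automaton I))).
  by exists s; rewrite // out /update /= reachabletE.
by apply: searchP => //; [exact: guard_bounded | exact: invariant_bounded].
Qed.
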